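(* Let $p$ be a prime and let $C_p>0$ be a constant such that for every $0<\delta\le 1$ and every function $u:\mathbb{F}_p^n\to\mathbb{C}$ (any $n$) with $\|u\|_\infty\le 1$ and $\|u\|_{U^3}\ge\delta$ there exists a quadratic form $q$ on $\mathbb{F}_p^n$ with $|\mathbb{E}_x u(x)\omega^{q(x)}|\ge\exp(-C_p\delta^{-C_p})$. Let $f:\mathbb{F}_p^n\to\mathbb{C}$ satisfy $\|f\|_2\le 1$, let $\delta>0$, $\eta>0$, and let $M=\exp(C_p(\eta\delta)^{-C_p})$. Then $f$ has a decomposition $$f(x)=\sum_i\lambda_i\omega^{q_i(x)}+g(x)+h(x),$$ where the sum is finite, the $\lambda_i$ are complex numbers, the $q_i$ are quadratic forms on $\mathbb{F}_p^n$, $g,h:\mathbb{F}_p^n\to\mathbb{C}$, and $$\eta^{-1}\|g\|_1+\delta^{-1}\|h\|_{U^3}+M^{-1}\sum_i|\lambda_i|\le 1.$$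
   Context: $\omega=e^{2\pi i/p}$; $\mathbb{E}$ denotes uniform average; $\|g\|_q=(\mathbb{E}_x|g(x)|^q)^{1/q}$ and $\|g\|_\infty=\max_x|g(x)|$. Here ''quadratic form'' on $\mathbb{F}_p^n$ is used in the sense of the $U^3$ inverse theorem: a polynomial map $\mathbb{F}_p^n\to\mathbb{F}_p$ of degree at most $2$ (the same class in the hypothesis and the conclusion). The $U^3$ norm is defined by $\|u\|_{U^3}^8=\mathbb{E}_{x,a,b,c}\prod_{\epsilon\in\{0,1\}^3}\mathcal{C}^{|\epsilon|}u(x+\epsilon_1a+\epsilon_2b+\epsilon_3c)$, where $\mathcal{C}$ denotes complex conjugation and $|\epsilon|=\epsilon_1+\epsilon_2+\epsilon_3$. *)

(* Defs.v *)
From HB Require Import structures.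
From mathcomp Require Import all_boot all_order all_algebra.
From mathcomp Require Import ring.
(* The notations of [mpoly] clash with those of mathcomp-analysis. *)
From mathcomp Require mpoly.
Import -(notations) mpoly.
From mathcomp Require Import all_classical all_reals all_analysis.
From mathcomp Require Import complex.

Set Implicit Arguments.
Unset Strict Implicit.
Unset Printing Implicit Defensive.

Import Order.TTheory GRing.Theory Num.Theory.
Local Open Scope ring_scope.
Local Open Scope complex_scope.

Definition avg (K : fieldType) (T : finType) (F : T -> K) : K :=
  (\sum_(x : T) F x) / #|T|%:R.

(* The library norm on [R[i]] takes its (real) values in [R[i]]. *)
Definition cmod (R : realType) (z : R[i]) : R := complex.Re `|z|.

Definition omega (R : realType) (p : nat) : R[i] :=
  cos (2 * pi / p%:R) +i* sin (2 * pi / p%:R).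

Definition norm_q (R : realType) (q : R) (T : finType) (g : T -> R[i]) : R :=
  avg (fun x => cmod (g x) `^ q) `^ q^-1.

Definition norm_oo (R : realType) (T : finType) (g : T -> R[i]) : R :=
  \big[Num.max/0]_(x : T) cmod (g x).

Definition U3_pow8 (R : realType) (T : finZmodType) (u : T -> R[i]) : R[i] :=
  avg (fun x => avg (fun a => avg (fun b => avg (fun c =>
    \prod_(e1 : bool) \prod_(e2 : bool) \prod_(e3 : bool)
      iter (e1 + e2 + e3) (@conjc R)
        (u (x + a *+ e1 + b *+ e2 + c *+ e3)))))).

(* [U3_pow8 u] is a nonnegative real (lemma [U3_pow8_ge0] below), so taking its
   real part loses nothing and [powR] is the genuine eighth root. *)
Definition norm_U3 (R : realType) (T : finZmodType) (u : T -> R[i]) : R :=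
  complex.Re (U3_pow8 u) `^ 8^-1.

(* [msize P] is one more than the total degree of [P], and [0] for [P = 0]. *)
Definition quadratic_form (p n : nat) (q : 'rV['F_p]_n -> 'F_p) : Prop :=
  exists2 P : mpoly n 'F_p,
    (mpoly.msize P <= 3)%N & forall x, q x = meval (fun i => x ord0 i) P.

(* The exponent is the representative of [q x] in [0, p). *)
Definition quadratic_phase (R : realType) (p n : nat)
    (q : 'rV['F_p]_n -> 'F_p) (x : 'rV['F_p]_n) : R[i] :=
  omega R p ^+ (q x : nat).

Lemma exchange_avg (K : fieldType) (S T : finType) (F : S -> T -> K) :
  avg (fun x => avg (fun y => F x y)) = avg (fun y => avg (fun x => F x y)).
Proof.
rewrite /avg -!mulr_suml exchange_big /= -!mulrA; congr (_ * _).
exact: mulrC.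
Qed.

Lemma eq_avg (K : fieldType) (T : finType) (F G : T -> K) :
  F =1 G -> avg F = avg G.
Proof. by move=> FG; rewrite /avg (eq_bigr G). Qed.

Lemma avg_ge0 (K : numFieldType) (T : finType) (F : T -> K) :
  (forall x, 0 <= F x) -> 0 <= avg F.
Proof. by move=> F0; rewrite mulr_ge0 ?sumr_ge0 ?invr_ge0 ?ler0n. Qed.

Lemma U3_pow8_ge0 (R : realType) (T : finZmodType) (u : T -> R[i]) :
  0 <= U3_pow8 u.
Proof.
rewrite /U3_pow8 exchange_avg; apply: avg_ge0 => a.
rewrite exchange_avg; apply: avg_ge0 => b.
pose D x := \prod_(e1 : bool) \prod_(e2 : bool)
  iter (e1 + e2) (@conjc R) (u (x + a *+ e1 + b *+ e2)).
rewrite (@eq_avg _ _ _ (fun x => avg (fun c => D x * conjc (D (x + c))))); last first.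
  move=> x; apply: eq_avg => c; rewrite /D !big_bool /= !rmorphM /= !conjcK.
  rewrite !mulr0n !mulr1n !addr0 ![x + c + a]addrAC ![_ + c + b]addrAC.
  by ring.
have -> : avg (fun x => avg (fun c => D x * conjc (D (x + c))))
          = avg D * conjc (avg D).
  transitivity (avg (fun x => D x * conjc (avg D))); last first.
    by rewrite /avg -mulr_suml mulrAC.
  apply: eq_avg => x; rewrite /avg -mulr_sumr -mulrA; congr (_ * _).
  rewrite rmorphM rmorph_sum /= fmorphV /= rmorph_nat; congr (_ / _).
  by rewrite [RHS](reindex_inj (addrI x)).
by rewrite -sqr_normc exprn_ge0.
Qed.

(* Main.v *)
Require Import Defs.
From mathcomp Require Import all_boot all_order all_algebra.
From mathcomp Require Import all_classical all_reals all_analysis.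
From mathcomp Require Import complex ring lra.

(* By Hahn-Banach duality.  If eta >= 1, take g = f.  Otherwise, if f has no
   decomposition of cost at most 1, there is psi with Re E(f psi) >= 1,
   |psi| <= 1/eta, Re E(h psi) <= |h|_U3 / delta for all h, and
   |E(omega^q psi)| <= 1/M for all quadratic q.  The first property and
   Cauchy-Schwarz give E|psi|^2 >= 1, and the third with h = conj psi then gives
   |psi|_U3 >= delta.  So eta psi is bounded by 1 and has U^3 norm at least
   eta delta, hence by hypothesis it correlates to at least 1/M with some
   omega^q, while duality bounds this correlation by eta/M < 1/M.  Convexity of
   the cost needs the triangle inequality for the U^3 norm, which follows from
   the Gowers-Cauchy-Schwarz inequality. *)

Set Implicit Arguments.
Unset Strict Implicit.
Unset Printing Implicit Defensive.

Import Order.TTheory GRing.Theory Num.Theory.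
Local Open Scope ring_scope.
Local Open Scope complex_scope.

(** * Moduli and averages *)

Section Modulus.
Context {R : realType}.
Implicit Types z w : R[i].

Lemma cmod_norm z : (cmod z)%:C = `|z|.
Proof. by []. Qed.

Lemma cmod_ge0 z : 0 <= cmod z.
Proof. by rewrite -ler0c cmod_norm. Qed.

Lemma cmodM z w : cmod (z * w) = cmod z * cmod w.
Proof. by apply: complexI; rewrite rmorphM /= !cmod_norm normrM. Qed.

Lemma cmodD z w : cmod (z + w) <= cmod z + cmod w.
Proof. by rewrite -lecR rmorphD /= !cmod_norm ler_normD. Qed.

Lemma cmodJ z : cmod (conjc z) = cmod z.
Proof. by rewrite /cmod normcJ. Qed.

Lemma cmod_nneg (r : R) : 0 <= r -> cmod r%:C = r.
Proof. by move=> r0; rewrite /cmod ger0_norm ?ler0c. Qed.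

Lemma cmod0 : cmod (0 : R[i]) = 0.
Proof. exact: cmod_nneg. Qed.

Lemma cmod_sum (I : finType) (F : I -> R[i]) :
  cmod (\sum_i F i) <= \sum_i cmod (F i).
Proof.
by elim/big_ind2: _ => [|x a y b xa yb|//]; rewrite ?cmod0 // (le_trans (cmodD _ _)) ?lerD.
Qed.

Lemma Re_le_cmod z : complex.Re z <= cmod z.
Proof. by rewrite (le_trans (ler_norm _)) // -lecR cmod_norm normc_ge_Re. Qed.

Lemma mulJc z : conjc z * z = (cmod z ^+ 2)%:C.
Proof. by rewrite mulrC -sqr_normc -cmod_norm rmorphXn. Qed.

End Modulus.

Section Average.

Lemma avgD (K : fieldType) (T : finType) (F G : T -> K) :
  avg (fun x => F x + G x) = avg F + avg G.
Proof. by rewrite /avg big_split mulrDl. Qed.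

Lemma avgZ (K : fieldType) (T : finType) (c : K) (F : T -> K) :
  avg (fun x => c * F x) = c * avg F.
Proof. by rewrite /avg -mulr_sumr mulrA. Qed.

Lemma avg_pair (K : fieldType) (S T : finType) (F : S -> T -> K) :
  avg (fun x => avg (F x)) = avg (fun xy : S * T => F xy.1 xy.2).
Proof.
rewrite /avg -mulr_suml pair_bigA /= -mulrA -invfM card_prod natrM.
by congr (_ / _); exact: mulrC.
Qed.

Lemma avg_cst (K : numFieldType) (T : finType) (c : K) :
  (0 < #|T|)%N -> avg (fun _ : T => c) = c.
Proof.
by move=> T0; rewrite /avg sumr_const -[c *+ _]mulr_natr mulfK // pnatr_eq0 -lt0n.
Qed.

Lemma avg_supp1 (K : fieldType) (T : finType) (x : T) (F : T -> K) :
  (forall y, y != x -> F y = 0) -> avg F = F x / #|T|%:R.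
Proof. by move=> F0; rewrite /avg (bigD1 x) //= big1 ?addr0. Qed.

Lemma le_avg (K : numFieldType) (T : finType) (F G : T -> K) :
  (forall x, F x <= G x) -> avg F <= avg G.
Proof. by move=> FG; rewrite ler_wpM2r ?invr_ge0 ?ler0n // ler_sum. Qed.

Lemma avg_real_complex (R : realType) (T : finType) (F : T -> R) :
  avg (fun x => (F x)%:C) = (avg F)%:C.
Proof. by rewrite /avg rmorphM /= fmorphV /= rmorph_nat rmorph_sum. Qed.

Lemma avg_conjc (R : realType) (T : finType) (F : T -> R[i]) :
  avg (fun x => conjc (F x)) = conjc (avg F).
Proof. by rewrite /avg rmorphM /= fmorphV /= rmorph_nat rmorph_sum. Qed.

Lemma Re_avg (R : realType) (T : finType) (F : T -> R[i]) :
  complex.Re (avg F) = avg (fun x => complex.Re (F x)).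
Proof.
have ReD : {morph @complex.Re R : z w / z + w} by case=> ? ? [].
have Re0 : complex.Re (0 : R[i]) = 0 by [].
rewrite /avg -(big_morph _ ReD Re0) -(rmorph_nat (real_complex R)) -fmorphV.
by case: (\sum_x F x) => a b /=; rewrite mulr0 subr0.
Qed.

Lemma cmod_avg (R : realType) (T : finType) (F : T -> R[i]) :
  cmod (avg F) <= avg (fun x => cmod (F x)).
Proof.
rewrite /avg cmodM -(rmorph_nat (real_complex R)) -fmorphV cmod_nneg ?invr_ge0 ?ler0n //.
by rewrite ler_wpM2r ?invr_ge0 ?ler0n ?cmod_sum.
Qed.

(** By Lagrange's identity, the double sum of [(F x * G y - F y * G x) ^+ 2] is twice the gap
    between the two sides, up to normalisation. *)
Lemma avg_cauchy_schwarz (R : realFieldType) (T : finType) (F G : T -> R) :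
  avg (fun x => F x * G x) ^+ 2
    <= avg (fun x => F x ^+ 2) * avg (fun x => G x ^+ 2).
Proof.
rewrite /avg exprMn [leRHS]mulrACA -[_^-1 * _^-1]expr2 ler_wpM2r ?sqr_ge0 //.
have H : 0 <= \sum_x \sum_y (F x * G y - F y * G x) ^+ 2.
  by do 2!(apply: sumr_ge0 => ? _); exact: sqr_ge0.
have E : \sum_x \sum_y (F x * G y - F y * G x) ^+ 2 =
  ((\sum_x F x ^+ 2) * (\sum_x G x ^+ 2) - (\sum_x F x * G x) ^+ 2) *+ 2.
  transitivity (\sum_x \sum_y (F x ^+ 2 * G y ^+ 2 + F y ^+ 2 * G x ^+ 2
                    - (F x * G x) * (F y * G y) *+ 2)).
    by apply: eq_bigr => x _; apply: eq_bigr => y _; ring.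
  under eq_bigr do rewrite !big_split /= -mulr_sumr -mulr_suml sumrN sumrMnl -mulr_sumr.
  rewrite !big_split /= sumrN sumrMnl -!mulr_suml -mulr_sumr; ring.
by rewrite E pmulrn_lge0 // subr_ge0 in H.
Qed.

End Average.

(** * The U^3 norm *)

(** [U] stands for the modulus of the Gowers inner product. Each hypothesis is Cauchy-Schwarz in one
    direction of the cube and removes the dependence on that coordinate; using all three in turn
    squares three times. *)
Lemma iterated_cauchy_schwarz (R : realDomainType) (S : Type)
    (U : (bool -> bool -> bool -> S) -> R) :
  (forall f, 0 <= U f) ->
  (forall f, U f ^+ 2 <= U (fun _ e2 e3 => f false e2 e3) * U (fun _ e2 e3 => f true e2 e3)) ->
  (forall f, U f ^+ 2 <= U (fun e1 _ e3 => f e1 false e3) * U (fun e1 _ e3 => f e1 true e3)) ->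
  (forall f, U f ^+ 2 <= U (fun e1 e2 _ => f e1 e2 false) * U (fun e1 e2 _ => f e1 e2 true)) ->
  forall f, U f ^+ 8 <=
    \prod_(e1 : bool) \prod_(e2 : bool) \prod_(e3 : bool) U (fun _ _ _ => f e1 e2 e3).
Proof.
move=> U0 cs1 cs2 cs3 f.
have sq k (x y z : R) : 0 <= x -> x ^+ 2 <= y * z ->
    x ^+ (2 * k) <= y ^+ k * z ^+ k.
  by move=> x0 h; rewrite exprM -exprMn lerXn2r ?nnegrE ?sqr_ge0 // (le_trans _ h) ?sqr_ge0.
rewrite !big_bool /=.
(* The first inequality is used to the fourth power, the second squared on two factors, the third on
   four. Factors are swapped because [big_bool] lists [true] first. *)
apply: le_trans (sq 4 _ _ _ (U0 _) (cs1 f)) _; rewrite [leLHS]mulrC.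
apply: ler_pM; rewrite ?exprn_ge0 //;
  apply: le_trans (sq 2 _ _ _ (U0 _) (cs2 _)) _; rewrite [leLHS]mulrC;
  apply: ler_pM; rewrite ?exprn_ge0 //; apply: le_trans (cs3 _) _;
  by rewrite [leLHS]mulrC.
Qed.

Section GowersNorm.
Context {R : realType} {T : finZmodType}.
Implicit Types (u v : T -> R[i]) (f : bool -> bool -> bool -> T -> R[i]).

Lemma finZmod_card_gt0 : (0 < #|T|)%N.
Proof. by apply/card_gt0P; exists 0. Qed.

(** The Gowers inner product of eight functions, one per vertex of the cube; it is convertible to
    [U3_pow8 u] when all of them are [u]. *)
Definition gowers_product f : R[i] :=
  avg (fun x => avg (fun a => avg (fun b => avg (fun c =>
    \prod_(e1 : bool) \prod_(e2 : bool) \prod_(e3 : bool)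
      iter (e1 + e2 + e3) (@conjc R)
        (f e1 e2 e3 (x + a *+ e1 + b *+ e2 + c *+ e3)))))).

Let slice f e a b x : R[i] := \prod_(e1 : bool) \prod_(e2 : bool)
  iter (e1 + e2) (@conjc R) (f e1 e2 e (x + a *+ e1 + b *+ e2)).

(** For fixed [a] and [b], the points [x] and [x + c] are independent and uniform, so the average
    factors over the two faces [e3 = false] and [e3 = true]; the second face carries one more
    conjugation. *)
Lemma gowers_product_slice f :
  gowers_product f = avg (fun a => avg (fun b =>
    avg (slice f false a b) * conjc (avg (slice f true a b)))).
Proof.
rewrite /gowers_product exchange_avg; apply: eq_avg => a.
rewrite exchange_avg; apply: eq_avg => b.
transitivity (avg (fun x => conjc (avg (slice f true a b)) * slice f false a b x)); last first.
  by rewrite avgZ mulrC.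
apply: eq_avg => x; rewrite mulrC.
have -> : avg (slice f true a b) = avg (fun c => slice f true a b (x + c)).
  by rewrite /avg [in LHS](reindex_inj (addrI x)).
rewrite -avg_conjc -avgZ; apply: eq_avg => c.
rewrite /slice !big_bool /= !rmorphM /= !conjcK.
rewrite !mulr0n !mulr1n !addr0 ![x + c + a]addrAC ![_ + c + b]addrAC.
by ring.
Qed.

Lemma cmod_gowers_product_slice f e :
  cmod (gowers_product (fun e1 e2 _ => f e1 e2 e)) =
  avg (fun a => avg (fun b => cmod (avg (slice f e a b)) ^+ 2)).
Proof.
rewrite gowers_product_slice -[RHS]cmod_nneg; last first.
  by apply: avg_ge0 => a; apply: avg_ge0 => b; rewrite exprn_ge0 ?cmod_ge0.
rewrite -avg_real_complex; congr cmod; apply: eq_avg => a.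
rewrite -avg_real_complex; apply: eq_avg => b.
by rewrite -mulJc mulrC.
Qed.

(** Cauchy-Schwarz over the pair [(a, b)], applied to the moduli of the two face averages. When the
    functions do not depend on [e3] the two faces agree, which yields the mean squares on the
    right. *)
Lemma gowers_cauchy_schwarz3 f :
  cmod (gowers_product f) ^+ 2 <=
  cmod (gowers_product (fun e1 e2 _ => f e1 e2 false)) *
  cmod (gowers_product (fun e1 e2 _ => f e1 e2 true)).
Proof.
rewrite [X in _ <= X * _](cmod_gowers_product_slice f false).
rewrite [X in _ <= _ * X](cmod_gowers_product_slice f true).
rewrite gowers_product_slice !avg_pair.
apply: le_trans (@avg_cauchy_schwarz R _
  (fun ab => cmod (avg (slice f false ab.1 ab.2)))
  (fun ab => cmod (avg (slice f true ab.1 ab.2)))).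
rewrite ler_pXn2r ?nnegrE ?cmod_ge0 //; last first.
  by apply: avg_ge0 => ab; rewrite mulr_ge0 ?cmod_ge0.
apply: le_trans (cmod_avg _) _; apply: le_avg => ab.
by rewrite cmodM cmodJ.
Qed.

(** Renaming [b] and [c] permutes the cube directions; such symmetries carry Cauchy-Schwarz from the
    third direction to the other two. *)
Lemma gowers_product_swap23 f :
  gowers_product f = gowers_product (fun e1 e2 e3 => f e1 e3 e2).
Proof.
apply: eq_avg => x; apply: eq_avg => a; rewrite exchange_avg.
apply: eq_avg => b; apply: eq_avg => c; apply: eq_bigr => e1 _.
rewrite exchange_big; apply: eq_bigr => e2 _; apply: eq_bigr => e3 _.
by rewrite addnAC -!addrA [c *+ _ + _]addrC.
Qed.

Lemma gowers_product_swap12 f :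
  gowers_product f = gowers_product (fun e1 e2 e3 => f e2 e1 e3).
Proof.
apply: eq_avg => x; rewrite exchange_avg.
apply: eq_avg => a; apply: eq_avg => b; apply: eq_avg => c.
rewrite exchange_big; apply: eq_bigr => e1 _; apply: eq_bigr => e2 _.
apply: eq_bigr => e3 _.
by rewrite [(e2 + e1)%N]addnC; congr (iter _ _ (f _ _ _ (_ + _))); rewrite addrAC.
Qed.

Lemma gowers_cauchy_schwarz2 f :
  cmod (gowers_product f) ^+ 2 <=
  cmod (gowers_product (fun e1 _ e3 => f e1 false e3)) *
  cmod (gowers_product (fun e1 _ e3 => f e1 true e3)).
Proof.
rewrite (gowers_product_swap23 f).
rewrite (gowers_product_swap23 (fun e1 _ e3 => f e1 false e3)).
rewrite (gowers_product_swap23 (fun e1 _ e3 => f e1 true e3)).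
exact: (gowers_cauchy_schwarz3 (fun e1 e2 e3 => f e1 e3 e2)).
Qed.

Lemma gowers_cauchy_schwarz1 f :
  cmod (gowers_product f) ^+ 2 <=
  cmod (gowers_product (fun _ e2 e3 => f false e2 e3)) *
  cmod (gowers_product (fun _ e2 e3 => f true e2 e3)).
Proof.
rewrite (gowers_product_swap12 f).
rewrite (gowers_product_swap12 (fun _ e2 e3 => f false e2 e3)).
rewrite (gowers_product_swap12 (fun _ e2 e3 => f true e2 e3)).
exact: (gowers_cauchy_schwarz2 (fun e1 e2 e3 => f e2 e1 e3)).
Qed.

Lemma norm_U3_ge0 u : 0 <= norm_U3 u.
Proof. exact: powR_ge0. Qed.

Lemma norm_U3_pow8 u : norm_U3 u ^+ 8 = complex.Re (U3_pow8 u).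
Proof.
have : 0 <= complex.Re (U3_pow8 u).
  by have := U3_pow8_ge0 u; rewrite lecE => /andP[].
move=> U0; rewrite /norm_U3 -powR_mulrn ?powR_ge0 // -powRrM mulVf ?pnatr_eq0 //.
by rewrite powRr1.
Qed.

Lemma cmod_U3_pow8 u : cmod (U3_pow8 u) = norm_U3 u ^+ 8.
Proof. by rewrite norm_U3_pow8 /cmod ger0_norm ?U3_pow8_ge0. Qed.

Lemma gowers_cauchy_schwarz f :
  cmod (gowers_product f) <=
  \prod_(e1 : bool) \prod_(e2 : bool) \prod_(e3 : bool) norm_U3 (f e1 e2 e3).
Proof.
rewrite -(@ler_pXn2r _ 8) ?nnegrE ?cmod_ge0 //; last first.
  by do 3!(apply: prodr_ge0 => ? _); exact: norm_U3_ge0.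
apply: le_trans (@iterated_cauchy_schwarz _ _ (fun g => cmod (gowers_product g))
  (fun _ => cmod_ge0 _) gowers_cauchy_schwarz1 gowers_cauchy_schwarz2
  gowers_cauchy_schwarz3 f) _.
rewrite -prodrXl; apply: ler_prod => e1 _; apply/andP; split.
  by do 2!(apply: prodr_ge0 => ? _); exact: cmod_ge0.
rewrite -prodrXl; apply: ler_prod => e2 _; apply/andP; split.
  by apply: prodr_ge0 => ? _; exact: cmod_ge0.
rewrite -prodrXl; apply: ler_prod => e3 _; rewrite cmod_ge0 -cmod_U3_pow8.
exact: lexx.
Qed.

Lemma norm_U3D u v : norm_U3 (fun x => u x + v x) <= norm_U3 u + norm_U3 v.
Proof.
(* [F z] has [z] in a single slot, the one that carries no conjugation, and [w]
   elsewhere; the product is additive in that slot. *)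
set w := fun x => _; pose F z e1 e2 e3 := if [|| e1, e2 | e3] then w else z : T -> R[i].
have E : U3_pow8 w = gowers_product (F u) + gowers_product (F v).
  rewrite -avgD; apply: eq_avg => x; rewrite -avgD; apply: eq_avg => a.
  rewrite -avgD; apply: eq_avg => b; rewrite -avgD; apply: eq_avg => c.
  rewrite !big_bool /= !mulr0n !addr0 -/w (_ : w x = u x + v x) //.
  by rewrite /F /= !mulrDr.
have FE (n : (T -> R[i]) -> R) z :
    \prod_(e1 : bool) \prod_(e2 : bool) \prod_(e3 : bool) n (F z e1 e2 e3) = n z * n w ^+ 7.
  by rewrite !big_bool /F /=; move: (n w) (n z) => r t; ring.
have B z : cmod (gowers_product (F z)) <= norm_U3 z * norm_U3 w ^+ 7.
  by rewrite -(FE (@norm_U3 R T)); exact: gowers_cauchy_schwarz.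
(* The bounds give [norm_U3 w ^+ 8 <= (norm_U3 u + norm_U3 v) * norm_U3 w ^+ 7]; cancelling the
   seventh power needs a nonzero norm. *)
have [w0|w0] := eqVneq (norm_U3 w) 0.
  by rewrite w0 addr_ge0 ?norm_U3_ge0.
have wp : 0 < norm_U3 w ^+ 7 by rewrite exprn_gt0 // lt_neqAle eq_sym w0 norm_U3_ge0.
rewrite -(ler_pM2r wp) -exprS -cmod_U3_pow8 E (le_trans (cmodD _ _)) //.
by rewrite mulrDl lerD.
Qed.

(** Reduces scaling and conjugation of the norm to identities between eighth powers, where no root
    appears. *)
Lemma norm_U3_unique u (r : R) :
  0 <= r -> cmod (U3_pow8 u) = r ^+ 8 -> norm_U3 u = r.
Proof.
by rewrite cmod_U3_pow8 => r0 h; apply: (pexpIrn _ _ _ h); rewrite ?nnegrE ?norm_U3_ge0.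
Qed.

Lemma U3_pow8Z (c : R) u : U3_pow8 (fun x => c%:C * u x) = (c ^+ 8)%:C * U3_pow8 u.
Proof.
have conjZ z : conjc (c%:C * z) = c%:C * conjc z by rewrite rmorphM /= oppr0.
have pull (k z1 z2 z3 z4 z5 z6 z7 z8 : R[i]) :
  k * z1 * (k * z2) * (k * z3 * (k * z4)) * (k * z5 * (k * z6) * (k * z7 * (k * z8)))
  = k ^+ 8 * (z1 * z2 * (z3 * z4) * (z5 * z6 * (z7 * z8))) by ring.
rewrite -avgZ; apply: eq_avg => x; rewrite -avgZ; apply: eq_avg => a.
rewrite -avgZ; apply: eq_avg => b; rewrite -avgZ; apply: eq_avg => e.
rewrite !big_bool /= !conjZ rmorphXn /=.
exact: pull.
Qed.

Lemma U3_pow8J u : U3_pow8 (fun x => conjc (u x)) = conjc (U3_pow8 u).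
Proof.
rewrite -avg_conjc; apply: eq_avg => x; rewrite -avg_conjc; apply: eq_avg => a.
rewrite -avg_conjc; apply: eq_avg => b; rewrite -avg_conjc; apply: eq_avg => e.
by rewrite !big_bool /= !rmorphM.
Qed.

Lemma norm_U3Z (c : R) u : 0 <= c -> norm_U3 (fun x => c%:C * u x) = c * norm_U3 u.
Proof.
move=> c0; apply: norm_U3_unique; first by rewrite mulr_ge0 ?norm_U3_ge0.
by rewrite exprMn U3_pow8Z cmodM cmod_U3_pow8 cmod_nneg ?exprn_ge0.
Qed.

Lemma norm_U3J u : norm_U3 (fun x => conjc (u x)) = norm_U3 u.
Proof.
by apply: norm_U3_unique; rewrite ?norm_U3_ge0 // U3_pow8J cmodJ cmod_U3_pow8.
Qed.

Lemma norm_U3_le1 u : (forall x, cmod (u x) <= 1) -> norm_U3 u <= 1.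
Proof.
move=> u1; rewrite -(@ler_pXn2r _ 8) ?nnegrE ?norm_U3_ge0 ?ler01 // expr1n -cmod_U3_pow8.
have A (F : T -> R[i]) : (forall x, cmod (F x) <= 1) -> cmod (avg F) <= 1.
  move=> F1; apply: le_trans (cmod_avg _) _.
  by rewrite -[leRHS](@avg_cst _ T 1) ?finZmod_card_gt0 //; exact: le_avg.
do 4!(apply: (A) => ?); rewrite !big_bool /= !cmodM !cmodJ.
by do !(apply: mulr_ile1; rewrite ?mulr_ge0 ?cmod_ge0 //).
Qed.

Lemma norm_U30 : norm_U3 (fun _ : T => 0 : R[i]) = 0.
Proof.
transitivity (norm_U3 (fun _ : T => 0%:C * (0 : R[i]))); first by rewrite mulr0.
by rewrite (norm_U3Z (fun _ => 0)) ?mul0r.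
Qed.

End GowersNorm.

(** * Hahn-Banach *)

Section HahnBanach.
Context {R : realType} {V : lmodType R}.
Implicit Types (N : V -> R) (x y v : V).

(** An inequality suffices for homogeneity: applying it to the inverse scalar gives equality. *)
Definition sublinear N : Prop :=
  (forall x y, N (x + y) <= N x + N y) /\
  (forall c x, 0 < c -> N (c *: x) <= c * N x).

(** Scaling by 2 gives [N 0 >= 0], and scaling by 1/2 gives [N 0 <= 0]. *)
Lemma sublinear0 N : sublinear N -> N 0 = 0.
Proof.
case=> _ NZ; have := NZ 2 0; have := NZ (2^-1) 0; rewrite !scaler0; lra.
Qed.

Lemma sublinear_oppr_ge N x : sublinear N -> - N (- x) <= N x.
Proof.
move=> sN; have := sN.1 x (- x); rewrite subrr sublinear0 //; lra.
Qed.

Lemma sublinear_inf (K : V -> set R) :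
  (forall x y c d, K x c -> K y d -> K (x + y) (c + d)) ->
  (forall t x c, 0 < t -> K x c -> K (t *: x) (t * c)) ->
  (forall x, nonempty (K x)) -> (forall x, has_lbound (K x)) ->
  sublinear (fun x => inf (K x)).
Proof.
move=> KD KZ K0 Kb; split=> [x y|t x t0] /=.
  rewrite -lerBlDr. apply: lb_le_inf => // c Kc.
  rewrite lerBlDr [leRHS]addrC -lerBlDr; apply: lb_le_inf => // d Kd.
  by rewrite lerBlDr [leRHS]addrC; apply: ge_inf => //; exact: KD.
rewrite -ler_pdivrMl //; apply: lb_le_inf => // c Kc.
by rewrite ler_pdivrMl //; apply: ge_inf => //; exact: KZ.
Qed.

(* [N'] is the infimum over [t >= 0] of [N (x + t v) - t N v]; taking [t = 1]
   at [- v] gives the last property. *)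
Lemma sublinear_odd_at N v : sublinear N ->
  exists N', [/\ sublinear N', forall x, N' x <= N x & N' (- v) <= - N v].
Proof.
move=> sN; have [ND NZ] := sN.
pose K x : set R := fun c => exists2 t : R, 0 <= t & N (x + t *: v) - t * N v <= c.
have NZ0 t x : 0 <= t -> N (t *: x) <= t * N x.
  rewrite le_eqVlt => /predU1P[<-|]; last exact: NZ.
  by rewrite scale0r mul0r sublinear0.
have lbK x : has_lbound (K x).
  (* Subadditivity gives [N (t *: v) <= N (x + t *: v) + N (- x)], and scaling back by [t^-1] gives
     [t * N v <= N (t *: v)]. *)
  exists (- N (- x)) => c [t t0]; apply: le_trans.
  have := ND (x + t *: v) (- x); rewrite addrAC subrr add0r => h.
  rewrite lerBrDr -lerBrDl opprK.
  have [->|tn0] := eqVneq t 0.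
    by rewrite mul0r scale0r addr0; have := sublinear_oppr_ge x sN; lra.
  have tp : 0 < t by rewrite lt_neqAle eq_sym tn0.
  have : t * N v <= N (t *: v).
    have := NZ t^-1 (t *: v); rewrite invr_gt0 scalerA mulVf // scale1r => /(_ tp).
    by rewrite ler_pdivlMl.
  lra.
have K1 x : K x (N x) by exists 0 => //; rewrite scale0r addr0 mul0r subr0.
exists (fun x => inf (K x)); split.
- apply: sublinear_inf => // [x y c d [s s0 sc] [t t0 td]|t x c t0 [s s0 sc]|x].
  + exists (s + t); first exact: addr_ge0.
    have := ND (x + s *: v) (y + t *: v).
    by rewrite addrACA -scalerDl mulrDl; lra.
  + exists (t * s); first by rewrite mulr_ge0 // ltW.
    rewrite -scalerA -scalerDr -mulrA lerBlDr.
    apply: le_trans (NZ _ _ t0) _; rewrite -mulrDr ler_pM2l //.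
    by rewrite -lerBlDr.
  + by exists (N x).
- by move=> x; exact: ge_inf.
- apply: ge_inf => //; exists 1 => //.
  by rewrite scale1r addNr sublinear0 // mul1r add0r.
Qed.

(** In finite dimension no maximality argument is needed: the functional is lowered to be odd at
    [v], then at each vector of [s] in turn. If [s] spans, the result is linear. *)
Lemma hahn_banach_seq (s : seq V) N v : sublinear N ->
  exists N', [/\ sublinear N', forall x, N' x <= N x, N v <= N' v
                & {in s, forall x, N' (- x) <= - N' x}].
Proof.
have odd_le N1 N2 x : sublinear N2 -> (forall y, N2 y <= N1 y) ->
    N1 (- x) <= - N1 x -> N2 (- x) <= - N2 x.
  by move=> s2 le21 h; have := le21 (- x); have := le21 x; lra.
have extend : forall (t : seq V) N1, sublinear N1 ->
    exists N2, [/\ sublinear N2, forall x, N2 x <= N1 x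
                  & {in t, forall x, N2 (- x) <= - N2 x}].
  elim=> [|x t IH] N1 s1; first by exists N1.
  have [N2 [s2 le21 oddx]] := sublinear_odd_at x s1.
  have [N3 [s3 le32 oddt]] := IH _ s2.
  exists N3; split=> // [y|y]; first exact: le_trans (le32 y) (le21 y).
  rewrite inE => /predU1P[->|]; last exact: oddt.
  (* Oddness survives later lowering: [N3 (- x) <= N2 (- x) <= - N1 x <= - N3 x]. *)
  by have := le32 (- x); have := le32 x; have := le21 x; lra.
move=> sN; have [N1 [s1 le1 oddv]] := sublinear_odd_at v sN.
have [N2 [s2 le2 odd2]] := extend s _ s1.
exists N2; split=> // [x|]; first exact: le_trans (le2 x) (le1 x).
(* The value at [v] is not lost: [N v <= - N1 (- v) <= - N2 (- v) <= N2 v]. *)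
by have := sublinear_oppr_ge v s2; have := le2 (- v); lra.
Qed.

End HahnBanach.

(** * Hahn-Banach for complex functions on a finite set *)

Section ComplexFunctions.
Context {R : realType} {T : finType}.

Lemma hahn_banach_avg (N : (T -> R[i]) -> R) :
  (forall f g, N (fun x => f x + g x) <= N f + N g) ->
  (forall (c : R) f, 0 < c -> N (fun x => c%:C * f x) <= c * N f) ->
  forall f, exists2 psi : T -> R[i],
    N f <= complex.Re (avg (fun x => f x * psi x)) &
    forall g, complex.Re (avg (fun x => g x * psi x)) <= N g.
Proof.
move=> ND NZ f.
(* [Rcomplex R] is the complex field viewed as a real vector space; the point masses with values 1
   and i form a real basis of the functions. *)
have scaleE (c : R) (z : Rcomplex R) : c *: z = c%:C * z :> R[i].
  by case: z => a b; apply/eqP; rewrite eq_complex /= !mul0r subr0 addr0 !eqxx.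
pose NV (g : T -> Rcomplex R) := N g.
have sN : sublinear NV.
  split=> [//|c g c0]; apply: le_trans (NZ c g c0).
  by rewrite le_eqVlt; apply/orP; left; apply/eqP; congr N; apply/funext => x; exact: scaleE.
pose e x (z : R[i]) : T -> Rcomplex R := fun y => if y == x then z else 0.
pose s := [seq e x z | x <- enum T, z <- [:: 1; 'i%C]].
have [L [sL leL fL oddL]] := hahn_banach_seq s f sN.
have Lodd x z : z \in [:: 1; 'i%C] -> L (- e x z) <= - L (e x z).
  by move=> zi; apply: oddL; apply: allpairs_f => //; rewrite mem_enum.
have LZ (c : R) x z : z \in [:: 1; 'i%C] -> L (c *: e x z) <= c * L (e x z).
  move=> zi; have [c0|c0|->] := ltgtP c 0; last by rewrite scale0r mul0r sublinear0.
    have := sL.2 (- c) (- e x z); rewrite oppr_gt0 scalerN scaleNr opprK => /(_ c0).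
    move=> h; apply: le_trans h _; rewrite mulNr -mulrN ler_nM2l // lerNr.
    exact: Lodd.
  exact: sL.2.
(* The real part of [(a + ib)(A - iB)] is [aA + bB], so [psi] represents the functional with the
   values of [L] on the basis; the factor [#|T|] cancels the averaging. *)
pose psi x : R[i] := (#|T|%:R : R)%:C * (L (e x 1) -i* L (e x 'i%C)).
have psiE g : complex.Re (avg (fun x => g x * psi x)) =
    \sum_x (complex.Re (g x) * L (e x 1) + complex.Im (g x) * L (e x 'i%C)).
  rewrite Re_avg /avg mulr_suml; apply: eq_bigr => x _.
  have T0 : #|T|%:R != 0 :> R by rewrite pnatr_eq0 -lt0n; apply/card_gt0P; exists x.
  by rewrite /psi; case: (g x) => a b /=; field.
have gE (g : T -> Rcomplex R) :
    g = \sum_x (complex.Re (g x) *: e x 1 + complex.Im (g x) *: e x 'i%C).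
  apply/funext => y; rewrite fct_sumE (bigD1 y) //= big1 => [|x xy].
    rewrite addr0 !fctE /e eqxx; case: (g y) => a b; apply/eqP.
    by rewrite eq_complex /= !mulr0 !mulr1 addr0 add0r !eqxx.
  by rewrite !fctE /e eq_sym (negPf xy) !scaler0 addr0.
have L_sum (F : T -> T -> Rcomplex R) : L (\sum_x F x) <= \sum_x L (F x).
  elim/big_ind2: _ => [|x a y b xa yb|//]; first by rewrite sublinear0.
  exact: le_trans (sL.1 _ _) (lerD xa yb).
have L_psi g : L g <= complex.Re (avg (fun x => g x * psi x)).
  rewrite psiE [X in L X]gE; apply: le_trans (L_sum _) _; apply: ler_sum => x _.
  by apply: le_trans (sL.1 _ _) _; apply: lerD; apply: LZ; rewrite !inE eqxx ?orbT.
exists psi => [|g]; first exact: le_trans fL (L_psi f).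
(* The bound [L_psi] at [- g] gives the reverse inequality: the pairing of [g] with [psi] is at most
   [- L (- g) <= L g <= N g]. *)
have := L_psi (- (g : T -> Rcomplex R)); have := sublinear_oppr_ge (g : T -> Rcomplex R) sL.
have -> : complex.Re (avg (fun x => (- (g : T -> Rcomplex R)) x * psi x)) =
          - complex.Re (avg (fun x => g x * psi x)).
  rewrite !psiE -sumrN; apply: eq_bigr => x _; rewrite !fctE.
  by case: (g x) => a b /=; rewrite !mulNr opprD.
have := leL g; rewrite /NV /=; lra.
Qed.

End ComplexFunctions.

(** * Duality for decompositions *)

Section Duality.
Context {R : realType} {T : finZmodType} {I : finType}.
Context (phi : I -> T -> R[i]) (r1 r2 r3 : R).
Context (r1_gt0 : 0 < r1) (r2_gt0 : 0 < r2) (r3_gt0 : 0 < r3).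
Implicit Types (f g h psi : T -> R[i]) (la : I -> R[i]).

Definition decomposition_cost la g h : R :=
  r1 * avg (fun x => cmod (g x)) + r2 * norm_U3 h + r3 * \sum_i cmod (la i).

(** Coefficients range over the whole finite family [I], so decompositions add coefficientwise. The
    set of admissible [c] is upward closed, and its infimum will be the sublinear functional. *)
Definition has_decomposition f (c : R) : Prop := exists la g h,
  (forall x, f x = \sum_i la i * phi i x + g x + h x) /\
  decomposition_cost la g h <= c.

Lemma has_decompositionD f1 f2 c1 c2 :
  has_decomposition f1 c1 -> has_decomposition f2 c2 ->
  has_decomposition (fun x => f1 x + f2 x) (c1 + c2).
Proof.
move=> [la1 [g1 [h1 [f1E d1]]]] [la2 [g2 [h2 [f2E d2]]]].
exists (fun i => la1 i + la2 i), (fun x => g1 x + g2 x), (fun x => h1 x + h2 x).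
split=> [x|].
  rewrite f1E f2E; under [in RHS]eq_bigr do rewrite mulrDl.
  by rewrite big_split /=; ring.
apply: le_trans (lerD d1 d2); rewrite /decomposition_cost [leRHS]addrACA.
rewrite [X in _ <= X + _]addrACA -!mulrDr.
apply: lerD; last first.
  by rewrite ler_pM2l // -big_split; apply: ler_sum => i _; exact: cmodD.
apply: lerD; last by rewrite ler_pM2l // norm_U3D.
by rewrite ler_pM2l // -avgD; apply: le_avg => x; exact: cmodD.
Qed.

Lemma has_decompositionZ (t : R) f c : 0 < t ->
  has_decomposition f c -> has_decomposition (fun x => t%:C * f x) (t * c).
Proof.
move=> t0 [la [g [h [fE d]]]]; have t0' := ltW t0.
exists (fun i => t%:C * la i), (fun x => t%:C * g x), (fun x => t%:C * h x).
split=> [x|].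
  rewrite fE !mulrDr mulr_sumr; congr (_ + _ + _).
  by apply: eq_bigr => i _; rewrite mulrA.
have -> : decomposition_cost (fun i => t%:C * la i) (fun x => t%:C * g x)
    (fun x => t%:C * h x) = t * decomposition_cost la g h; last by rewrite ler_pM2l.
rewrite /decomposition_cost norm_U3Z // !mulrDr; congr (_ + _ + _).
- rewrite [RHS]mulrCA; congr (_ * _); rewrite -avgZ.
  by apply: eq_avg => x; rewrite cmodM cmod_nneg.
- exact: mulrCA.
- rewrite [RHS]mulrCA; congr (_ * _); rewrite mulr_sumr.
  by apply: eq_bigr => i _; rewrite cmodM cmod_nneg.
Qed.

Lemma decomposition_cost_ge0 la g h : 0 <= decomposition_cost la g h.
Proof.
have posM (r a : R) : 0 < r -> 0 <= a -> 0 <= r * a by move=> /ltW; exact: mulr_ge0.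
apply: addr_ge0; first apply: addr_ge0; apply: posM => //; last 2 first.
- exact: norm_U3_ge0.
- by apply: sumr_ge0 => i _; exact: cmod_ge0.
- by apply: avg_ge0 => x; exact: cmod_ge0.
Qed.

(** This and the next two lemmas give decompositions with a single component; pairing them with the
    dual function yields its three bounds. *)
Lemma has_decomposition_L1 f : has_decomposition f (r1 * avg (fun x => cmod (f x))).
Proof.
exists (fun _ => 0), f, (fun _ => 0); split=> [x|].
  by rewrite big1 ?add0r ?addr0 // => i _; rewrite mul0r.
rewrite /decomposition_cost norm_U30 mulr0 addr0 big1 ?mulr0 ?addr0 // => i _.
exact: cmod0.
Qed.

Lemma has_decomposition_U3 f : has_decomposition f (r2 * norm_U3 f).
Proof.
exists (fun _ => 0), (fun _ => 0), f; split=> [x|].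
  by rewrite big1 ?add0r // => i _; rewrite mul0r.
rewrite /decomposition_cost [X in r1 * X](_ : _ = 0).
  by rewrite mulr0 add0r big1 ?mulr0 ?addr0 // => i _; exact: cmod0.
by rewrite /avg big1 ?mul0r // => x _; exact: cmod0.
Qed.

Lemma has_decomposition_phi i z :
  has_decomposition (fun x => z * phi i x) (r3 * cmod z).
Proof.
exists (fun j => if j == i then z else 0), (fun _ => 0), (fun _ => 0); split=> [x|].
  rewrite (bigD1 i) //= eqxx big1 ?addr0 // => j /negPf ->; exact: mul0r.
rewrite /decomposition_cost norm_U30 mulr0 addr0 [X in r1 * X](_ : _ = 0).
  rewrite mulr0 add0r (bigD1 i) //= eqxx big1 ?addr0 // => j /negPf ->; exact: cmod0.
by rewrite /avg big1 ?mul0r // => x _; exact: cmod0.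
Qed.

(** The infimal cost [N] is sublinear. If [N f < 1], some decomposition costs at most 1, whether or
    not the infimum is attained; otherwise Hahn-Banach at [f] supplies [psi]. *)
Lemma decomposition_duality f :
  has_decomposition f 1 \/
  exists psi, [/\ 1 <= complex.Re (avg (fun x => f x * psi x)),
    forall x, cmod (psi x) <= r1,
    forall h, complex.Re (avg (fun x => h x * psi x)) <= r2 * norm_U3 h &
    forall i, cmod (avg (fun x => phi i x * psi x)) <= r3].
Proof.
have D0 g c : has_decomposition g c -> 0 <= c.
  by case=> la [g' [h [_]]]; apply: le_trans; exact: decomposition_cost_ge0.
have lb g : has_lbound (has_decomposition g) by exists 0 => c; exact: D0.
have ne g : nonempty (has_decomposition g).
  by exists (r1 * avg (fun x => cmod (g x))); exact: has_decomposition_L1.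
pose N g := inf (has_decomposition g).
have Nle g c : has_decomposition g c -> N g <= c by exact: ge_inf.
have [N1|N1] := ltP (N f) 1.
  left; have N1' : 0 < 1 - N f by rewrite subr_gt0.
  have [c [la [g [h [fE dc]]]]] := inf_adherent N1' (conj (ne f) (lb f)).
  rewrite addrC subrK => c1; exists la, g, h; split=> //.
  exact: le_trans dc (ltW c1).
right; have ND g h : N (fun x => g x + h x) <= N g + N h.
  rewrite -lerBlDr; apply: lb_le_inf => // c Kc.
  rewrite lerBlDr [leRHS]addrC -lerBlDr; apply: lb_le_inf => // d Kd.
  by rewrite lerBlDr [leRHS]addrC; apply: Nle; exact: has_decompositionD.
have NZ (c : R) g : 0 < c -> N (fun x => c%:C * g x) <= c * N g.
  move=> c0; rewrite -ler_pdivrMl //; apply: lb_le_inf => // d Kd.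
  by rewrite ler_pdivrMl //; apply: Nle; exact: has_decompositionZ.
have [psi fpsi psiN] := hahn_banach_avg ND NZ f.
exists psi; split=> [|x|h|i]; first exact: le_trans fpsi.
(* A point mass at [x] of value [conjc (psi x)] gives [cmod (psi x) ^+ 2 <= r1 * cmod (psi x)],
   after cancelling [#|T|]. *)
- have := le_trans (psiN (fun y => if y == x then conjc (psi x) else 0))
    (Nle _ _ (has_decomposition_L1 _)).
  rewrite Re_avg (@avg_supp1 _ _ x) => [|y /negPf ->]; last by rewrite mul0r.
  rewrite (@avg_supp1 _ _ x) => [|y /negPf ->]; last exact: cmod0.
  rewrite eqxx.
  rewrite mulJc cmodJ mulrA ler_pM2r ?invr_gt0 ?ltr0n ?finZmod_card_gt0 // expr2.
  have [->|p0] := eqVneq (cmod (psi x)) 0; first by move=> _; exact: ltW.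
  by rewrite ler_pM2r // lt_neqAle eq_sym p0 cmod_ge0.
- exact: le_trans (psiN h) (Nle _ _ (has_decomposition_U3 _)).
(* The coefficient [conjc w] makes the pairing real and gives [cmod w ^+ 2 <= r3 * cmod w]. *)
- set w := avg _.
  have := le_trans (psiN (fun x => conjc w * phi i x))
    (Nle _ _ (has_decomposition_phi i (conjc w))).
  under eq_avg do rewrite -mulrA.
  rewrite avgZ -/w mulJc cmodJ expr2 /=.
  have [->|w0] := eqVneq (cmod w) 0; first by move=> _; exact: ltW.
  by rewrite ler_pM2r // lt_neqAle eq_sym w0 cmod_ge0.
Qed.

End Duality.

(** * Normalised L^1, L^2 and sup norms *)

Section NormQ.
Context {R : realType} {T : finType}.
Implicit Types f g : T -> R[i].

Lemma norm_q1E g : norm_q 1 g = avg (fun x => cmod (g x)).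
Proof.
rewrite /norm_q invr1 powRr1; last by apply: avg_ge0 => x; exact: powR_ge0.
by apply: eq_avg => x; rewrite powRr1 ?cmod_ge0.
Qed.

Lemma norm_q2_sqr f : norm_q 2 f ^+ 2 = avg (fun x => cmod (f x) ^+ 2).
Proof.
have a0 : 0 <= avg (fun x => cmod (f x) `^ 2) by apply: avg_ge0 => x; exact: powR_ge0.
rewrite /norm_q -powR_mulrn ?powR_ge0 // -powRrM mulVf ?pnatr_eq0 // powRr1 //.
by apply: eq_avg => x; rewrite powR_mulrn ?cmod_ge0.
Qed.

Lemma avg_cmod_mul_le f g :
  norm_q 2 f <= 1 -> avg (fun x => cmod (f x) * cmod (g x)) ^+ 2
    <= avg (fun x => cmod (g x) ^+ 2).
Proof.
move=> f1; apply: le_trans (@avg_cauchy_schwarz R T _ _) _.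
rewrite -(norm_q2_sqr f); apply: ler_piMl.
  by apply: avg_ge0 => x; rewrite exprn_ge0 ?cmod_ge0.
by rewrite exprn_ile1 ?powR_ge0.
Qed.

Lemma norm_oo_le g (c : R) :
  0 <= c -> (forall x, cmod (g x) <= c) -> norm_oo g <= c.
Proof.
move=> c0 gc; rewrite /norm_oo; elim/big_ind: _ => // a b ac bc.
by rewrite ge_max ac.
Qed.

End NormQ.

(** Cauchy-Schwarz against the constant function 1. *)
Lemma norm_q1_le1 (R : realType) (T : finZmodType) (f : T -> R[i]) :
  norm_q 2 f <= 1 -> norm_q 1 f <= 1.
Proof.
move=> f1; rewrite norm_q1E; have a0 : 0 <= avg (fun x => cmod (f x)).
  by apply: avg_ge0 => x; exact: cmod_ge0.
rewrite -(@ler_pXn2r _ 2) ?nnegrE ?ler01 // expr1n.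
have := avg_cmod_mul_le (fun _ => 1) f1.
have c1 : cmod (1 : R[i]) = 1 by apply: cmod_nneg; exact: ler01.
under eq_avg do rewrite c1 mulr1.
by under [X in _ <= X]eq_avg do rewrite c1 expr1n; rewrite (@avg_cst _ T 1) ?finZmod_card_gt0.
Qed.

(** * Decomposition into quadratic phases *)

Theorem theorem2p5 (R : realType) (p : nat) (p_prime : prime p)
    (Cp : R) (Cp_gt0 : 0 < Cp)
    (U3_inverse : forall (n : nat) (delta : R) (u : 'rV['F_p]_n -> R[i]),
       0 < delta -> delta <= 1 -> norm_oo u <= 1 -> delta <= norm_U3 u ->
       exists2 q : 'rV['F_p]_n -> 'F_p, quadratic_form q &
         expR (- Cp * delta `^ (- Cp))
           <= cmod (avg (fun x => u x * quadratic_phase R q x)))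
    (n : nat) (f : 'rV['F_p]_n -> R[i]) (f_le1 : norm_q 2 f <= 1)
    (delta eta : R) (delta_gt0 : 0 < delta) (eta_gt0 : 0 < eta) :
  let M := expR (Cp * (eta * delta) `^ (- Cp)) in
  exists (m : nat) (lambda : 'I_m -> R[i])
         (q : 'I_m -> 'rV['F_p]_n -> 'F_p) (g h : 'rV['F_p]_n -> R[i]),
    [/\ forall i, quadratic_form (q i),
        forall x, f x = \sum_(i < m) lambda i * quadratic_phase R (q i) x
                        + g x + h x
      & eta^-1 * norm_q 1 g + delta^-1 * norm_U3 h
          + M^-1 * \sum_(i < m) cmod (lambda i) <= 1].
Proof.
move=> M; have M0 : 0 < M by exact: expR_gt0.
have [eta1|eta1] := leP 1 eta.
  exists 0%N, (fun _ => 0), (fun _ _ => 0), f, (fun _ => 0); split=> [[]//|x|].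
    by rewrite big_ord0 add0r addr0.
  rewrite norm_U30 big_ord0 !mulr0 !addr0 mulrC ler_pdivrMr // mul1r.
  by rewrite (le_trans _ eta1) // norm_q1_le1.
(* Quadratic forms are taken as functions rather than polynomials, so that they make up a finite
   type to index the coefficients. *)
pose I := {q : {ffun 'rV['F_p]_n -> 'F_p} | `[< quadratic_form (q : _ -> _) >]}.
pose phi (i : I) := quadratic_phase R (val i : _ -> _).
have inv_gt0 (r : R) : 0 < r -> 0 < r^-1 by rewrite invr_gt0.
have [[la [g [h [fE cost]]]]|[psi [fpsi psi_eta psi_delta psi_M]]] :=
  decomposition_duality phi (inv_gt0 _ eta_gt0) (inv_gt0 _ delta_gt0) (inv_gt0 _ M0) f.
  exists #|{: I}|, (fun i => la (enum_val i)), (fun i => val (enum_val i : I) : _ -> _), g, h.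
  split=> [i|x|].
  - by have /asboolP := valP (enum_val i : I).
  - rewrite fE; congr (_ + _ + _).
    by rewrite (big_enum_val (fun i : I => la i * phi i x)).
  - move: cost; rewrite /decomposition_cost norm_q1E.
    by rewrite (big_enum_val (fun i : I => cmod (la i))).
exfalso.
have psi2 : 1 <= avg (fun x => cmod (psi x) ^+ 2).
  apply: le_trans (avg_cmod_mul_le psi f_le1).
  rewrite -[leLHS](expr1n _ 2) ler_pXn2r ?nnegrE ?ler01 //; last first.
    by apply: avg_ge0 => x; rewrite mulr_ge0 ?cmod_ge0.
  apply: le_trans fpsi _; apply: le_trans (Re_le_cmod _) _.
  by apply: le_trans (cmod_avg _) _; apply: le_avg => x; rewrite cmodM.
have psi_U3 : delta <= norm_U3 psi.
  have := psi_delta (fun x => conjc (psi x)).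
  under eq_avg do rewrite mulJc.
  rewrite avg_real_complex norm_U3J /= => /(le_trans psi2).
  by rewrite mulrC ler_pdivlMr // mul1r.
pose u x := eta%:C * psi x.
have u1 x : cmod (u x) <= 1.
  by rewrite /u cmodM (cmod_nneg (ltW eta_gt0)) -ler_pdivlMl // mulr1.
have u_U3 : eta * delta <= norm_U3 u.
  by rewrite (norm_U3Z _ (ltW eta_gt0)) ler_pM2l.
(* The requirement [eta * delta <= 1] of the inverse theorem follows from [norm_U3 u <= 1]. *)
have [q qquad uq] := U3_inverse n (eta * delta) u (mulr_gt0 eta_gt0 delta_gt0)
  (le_trans u_U3 (norm_U3_le1 u1)) (norm_oo_le ler01 u1) u_U3.
have qI : `[< quadratic_form ([ffun x => q x] : {ffun 'rV['F_p]_n -> 'F_p}) >].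
  by apply/asboolP; case: qquad => P P3 qP; exists P => // x; rewrite ffunE.
have psi_q : cmod (avg (fun x => quadratic_phase R q x * psi x)) <= M^-1.
  have := psi_M (exist _ [ffun x => q x] qI : I).
  by under eq_avg => x do rewrite /phi /quadratic_phase /= ffunE.
have uE : avg (fun x => u x * quadratic_phase R q x) =
    eta%:C * avg (fun x => quadratic_phase R q x * psi x).
  by rewrite -avgZ; apply: eq_avg => x; rewrite /u -mulrA [psi x * _]mulrC.
(* The lower bound of the inverse theorem is exactly [M^-1], so [M^-1 <= eta * M^-1], against
   [eta < 1]. *)
rewrite uE cmodM (cmod_nneg (ltW eta_gt0)) mulNr expRN -/M in uq.
rewrite -(ler_pM2l eta_gt0) in psi_q.
have := le_trans uq psi_q; rewrite ler_pMl ?invr_gt0 //.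
by rewrite leNgt eta1.
Qed.
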